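(* Let $d_x\ge 1$, let $\Omega\subset\mathbb{R}^{d_x}$ be compact, let $T>0$, and let $\sigma:\mathbb{R}\to\mathbb{R}$ be any continuous sigmoidal function. Then finite sums of the form $$G_C(\boldsymbol{x},t)=\sum_{j=1}^{N}u_j\,\sigma\big((\boldsymbol{k}_j^{x})^\top\boldsymbol{x}+k_j^{t}t+b_j\big),\qquad N\in\mathbb{N}^+,\ u_j,k_j^t,b_j\in\mathbb{R},\ \boldsymbol{k}_j^x\in\mathbb{R}^{d_x},$$ are dense in $C(\Omega\times[0,T])$. In other words, given any $f\in C(\Omega\times[0,T])$ and $\epsilon>0$, there exists a sum $G_C(\boldsymbol{x},t)=\sum_{j=1}^{N}u_j\,\sigma\big((\boldsymbol{k}_j^{x})^\top\boldsymbol{x}+k_j^{t}t+b_j\big)$, with $N\in\mathbb{N}^+$, $u_j,k_j^t,b_j\in\mathbb{R}$ and $\boldsymbol{k}_j^x\in\mathbb{R}^{d_x}$, such that $|G_C(\boldsymbol{x},t)-f(\boldsymbol{x},t)|<\epsilon$ for all $(\boldsymbol{x},t)\in\Omega\times[0,T]$.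
   Context: A function $\sigma:\mathbb{R}\to\mathbb{R}$ is called sigmoidal if $\sigma(z)\to 1$ as $z\to+\infty$ and $\sigma(z)\to 0$ as $z\to-\infty$. $C(\Omega\times[0,T])$ is the space of real-valued continuous functions with the supremum norm. *)

(* Defs.v *)
From mathcomp Require Import all_boot all_order all_algebra.
From mathcomp Require Import all_classical all_reals all_analysis.
Import Order.TTheory GRing.Theory Num.Theory.
Import numFieldNormedType.Exports.

Set Implicit Arguments.
Unset Strict Implicit.
Unset Printing Implicit Defensive.

Local Open Scope classical_set_scope.
Local Open Scope ring_scope.

Definition sigmoidal (R : realType) (sigma : R -> R) : Prop :=
  sigma z @[z --> +oo] --> (1 : R) /\ sigma z @[z --> -oo] --> (0 : R).

(* C(K), for K a subset of X seen as a subtype: the continuous functions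
   K -> R with the topology of uniform convergence on K. For K compact this is
   the topology of the supremum norm, see nbhs_CspaceP. *)
Definition Cspace (R : realType) (X : topologicalType) (K : set X) :=
  initial_topology
    (id : continuousType (set_type K) R -> {uniform (set_type K) -> R}).

(* On empty K, sup set0 = 0. *)
Definition supnorm (R : realType) (X : Type) (K : set X)
  (h : set_type K -> R) : R := sup (range (fun z => `|h z|)).

Lemma nbhs_CspaceP (R : realType) (X : topologicalType) (K : set X)
    (f : Cspace R K) (A : set (Cspace R K)) : compact K ->
  nbhs f A <->
  exists2 e : R, 0 < e &
    forall g : Cspace R K, supnorm (fun z => g z - f z) < e -> A g.
Proof.
move=> cK.
have ubd (h : set_type K -> R) : continuous h ->
    has_ubound (range (fun z => `|h z|)).
  move=> /(subspace_valL_continuousP' _ (0 : R)) ch.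
  have [M [_ HM]] := compact_bounded (continuous_compact ch cK).
  exists (M + 1) => _ [z _ <-]; apply: HM; first by rewrite ltrDl.
  by exists (set_val z); [exact: set_valP | by rewrite -[in RHS](valLK (0 : R) h)].
split=> [|[e e0 eA]].
  rewrite nbhsE => -[_ [[W oW <-] /= Wf] WA].
  have /uniform_nbhs [E [entE EW]] : nbhs (f : {uniform (set_type K) -> R}) W.
    exact: open_nbhs_nbhs.
  move: entE; rewrite -entourage_ballE => -[e /= e0 eE].
  exists e => // g ge; apply/WA/EW => y _; apply/eE => /=.
  rewrite -ball_normE /= distrC; apply: le_lt_trans ge.
  have cg : continuous (g : set_type K -> R) := @cts_fun _ _ g.
  have cf : continuous (f : set_type K -> R) := @cts_fun _ _ f.
  apply: ub_le_sup; last by exists y.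
  apply: (ubd (fun z => g z - f z)) => z.
  exact: (continuousB (cg z) (cf z)).
have nV : nbhs (f : {uniform (set_type K) -> R})
    [set h | forall z, `|h z - f z| < e / 2].
  apply/uniform_nbhs; exists [set xy | ball xy.1 (e / 2) xy.2]; split.
    by rewrite -entourage_ballE; exists (e / 2); rewrite /= ?divr_gt0.
  by move=> h /= hE y; have := hE y Logic.I; rewrite -ball_normE /= distrC.
suff sA : (id : continuousType (set_type K) R ->
    {uniform (set_type K) -> R}) @^-1`
    [set h | forall z, `|h z - f z| < e / 2] `<=` A.
  by apply: filterS sA _; exact: initial_continuous nV.
move=> g /= gV; apply: eA.
apply: (@le_lt_trans _ _ (e / 2)); last first.
  by rewrite ltr_pdivrMr // ltr_pMr // ltr1n.
rewrite /supnorm; set S := (X in sup X).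
have [->|/set0P S0] := eqVneq S set0; first by rewrite sup0 divr_ge0 // ltW.
by apply: ge_sup => // _ [z _ <-]; exact/ltW/gV.
Qed.

Definition spacetime (R : realType) (d : nat) (Omega : set 'cV[R]_d) (T : R) :
  set ('cV[R]_d * R) := Omega `*` `[0, T].

Definition ridge_sum (R : realType) (sigma : R -> R) (d N : nat)
    (u : 'I_N -> R) (kx : 'I_N -> 'cV[R]_d) (kt b : 'I_N -> R)
    (x : 'cV[R]_d) (t : R) : R :=
  \sum_(j < N) u j * sigma (((kx j)^T *m x) 0 0 + kt j * t + b j).

Definition ridge_sums (R : realType) (sigma : R -> R) (d : nat)
    (K : set ('cV[R]_d * R)) : set (Cspace R K) :=
  [set g | exists (N : nat) (u : 'I_N -> R) (kx : 'I_N -> 'cV[R]_d)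
      (kt b : 'I_N -> R), (0 < N)%N /\
    forall z : set_type K,
      g z = ridge_sum sigma u kx kt b (set_val z).1 (set_val z).2].

Arguments ridge_sums {R} sigma {d} K.

(* Main.v *)
(* Products of exponentials of linear forms are again such exponentials, so by
   the Stone-Weierstrass theorem their linear combinations are dense in C(K),
   K compact. On K a linear form takes values in a segment, so each exponential
   is a Lipschitz function of one variable; step functions with steps smoothed
   into steep translates of sigma approximate it, and each smoothed step is a
   ridge function of the required shape. *)
Require Import Defs.
From mathcomp Require Import all_boot all_order all_algebra.
From mathcomp Require Import all_classical all_reals all_analysis.
From mathcomp Require Import ring lra.
Import Order.TTheory GRing.Theory Num.Theory.
Import numFieldNormedType.Exports.
Local Open Scope classical_set_scope.
Local Open Scope ring_scope.

(** * Lattice approximation on compact sets *)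

(** Directedness makes the sets of all [c] in [D] with [P a] included in [P c] a filter base;
    near-covering compactness of [K] then turns local indices into a single one. *)
Lemma compact_directed (X : topologicalType) (K : set X) (T : Type)
    (D : set T) (P : T -> X -> Prop) :
  compact K -> D !=set0 ->
  (forall a b, D a -> D b -> exists2 c, D c & forall x, P a x \/ P b x -> P c x) ->
  (forall x, K x -> exists2 a, D a & \forall y \near x, P a y) ->
  exists2 a, D a & forall x, K x -> P a x.
Proof.
move=> /compact_near_coveringP cK D0 Ddir Ploc.
pose F := filter_from D (fun a => [set c | D c /\ forall x, P a x -> P c x]).
have FF : Filter F.
  apply: filter_from_filter => // a b Da Db.
  have [c Dc abc] := Ddir a b Da Db; exists c => // t [Dt ct].
  by split; split=> // x Px; apply/ct/abc; [left|right].
have Fnear : \near F, K `<=` P F.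
  apply: cK => x Kx; have [a Da nPa] := Ploc x Kx.
  exists ([set y | P a y], [set c | D c /\ forall x, P a x -> P c x]) => /=.
    by split=> //; exists a.
  by move=> [y c] /= [Pay [_]]; exact.
have [a Da aP] : exists2 a, D a & K `<=` P a.
  by case: Fnear => a Da aP; exists a => //; apply: aP.
by exists a.
Qed.

(** Stone's lattice argument: for fixed [x], maxima of interpolants at [x] and [y] exceed [f - e] on
    all of [K] and stay below [f + e] at [x]; minima of these as [x] varies then fall below [f + e]
    on all of [K]. *)
Lemma lattice_approx (R : realType) (X : topologicalType) (K : set X)
    (L : set (X -> R)) (f : X -> R) :
  compact K -> continuous f -> (forall g, L g -> continuous g) -> L !=set0 ->
  (forall g h, L g -> L h -> L (fun x => Num.max (g x) (h x))) ->
  (forall g h, L g -> L h -> L (fun x => Num.min (g x) (h x))) ->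
  (forall x y e, K x -> K y -> 0 < e ->
    exists2 g, L g & `|g x - f x| < e /\ `|g y - f y| < e) ->
  forall e, 0 < e -> exists2 g, L g & forall x, K x -> `|g x - f x| < e.
Proof.
move=> cK cf cL L0 Lmax Lmin Lint e e0.
have near_lt (g h : X -> R) x : continuous g -> continuous h -> g x < h x ->
    \forall y \near x, g y < h y.
  move=> cg ch gh; have : \forall y \near x, 0 < h y - g y.
    have /cvgr_gt : h y - g y @[y --> x] --> h x - g x.
      by apply: cvgB; [exact: ch|exact: cg].
    by apply; rewrite subr_gt0.
  by apply: filterS => y; rewrite subr_gt0.
have cfD c : continuous (fun x => f x + c).
  by move=> x; apply: continuousD; [exact: cf|exact: cst_continuous].
have low x : K x -> exists2 h, L h & h x < f x + e /\
    forall y, K y -> f y - e < h y.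
  move=> Kx.
  have [h [Lh hx] hK] : exists2 h, [set h | L h /\ h x < f x + e] h &
      forall y, K y -> f y - e < h y.
    apply: compact_directed => //.
    - have [g Lg [gx _]] := Lint x x e Kx Kx e0.
      by exists g; split=> //; move: gx; rewrite ltr_norml ltrBlDl => /andP[].
    - move=> a b [La ax] [Lb bx]; exists (fun y => Num.max (a y) (b y)).
        by split; [exact: Lmax|rewrite gt_max ax].
      by move=> y [] ay; rewrite lt_max ay ?orbT.
    - move=> y Ky; have [g Lg [gx gy]] := Lint x y e Kx Ky e0.
      exists g; first by split=> //; move: gx; rewrite ltr_norml ltrBlDl => /andP[].
      apply: near_lt (cfD _) (cL _ Lg) _.
      by move: gy; rewrite ltr_norml ltrBrDl => /andP[].
  by exists h.
have [h [Lh hl] hu] : exists2 h, [set h | L h /\ forall y, K y -> f y - e < h y] h &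
    forall y, K y -> h y < f y + e.
  apply: compact_directed => //.
  - have [->|/set0P[x Kx]] := eqVneq K set0.
      by case: L0 => g Lg; exists g; split.
    by have [h Lh [_ hl]] := low x Kx; exists h.
  - move=> a b [La ax] [Lb bx]; exists (fun y => Num.min (a y) (b y)).
      by split; [exact: Lmin|move=> y Ky; rewrite lt_min ax ?bx].
    by move=> y [] ay; rewrite gt_min ay ?orbT.
  - move=> y Ky; have [h Lh [hy hl]] := low y Ky; exists h => //.
    exact: near_lt (cL _ Lh) (cfD _) hy.
exists h => // x Kx; rewrite ltr_norml ltrBlDl hu // andbT.
by rewrite ltrBrDl hl.
Qed.

(** * Uniform closure and the Stone-Weierstrass theorem *)

Definition uniform_closure {R : realType} {X : Type} (K : set X)
    (B : set (X -> R)) : set (X -> R) :=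
  [set f | forall e, 0 < e -> exists2 g, B g & forall x, K x -> `|g x - f x| < e].

(* On [-1, 1] these polynomials in [x ^+ 2] increase to [`|x|]. *)
Definition abs_iter {R : realType} (n : nat) (x : R) : R :=
  iter n (fun y => y + (x ^+ 2 - y ^+ 2) / 2) 0.

(** One iteration multiplies the error [|x| - y] by [1 - (|x| + y) / 2], which preserves
    [0 <= y <= |x|]. The rate follows by induction on the bound for the error times [n + 2]. *)
Lemma abs_iter_bound (R : realType) (n : nat) (x : R) : `|x| <= 1 ->
  0 <= `|x| - abs_iter n x <= 2 / n.+2%:R.
Proof.
move=> x1.
suff [p0 px pn] : [/\ 0 <= abs_iter n x, abs_iter n x <= `|x| &
    (`|x| - abs_iter n x) * n.+2%:R <= 2].
  by rewrite subr_ge0 px /= ler_pdivlMr.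
elim: n => [|n [p0 px pn]].
  by rewrite /abs_iter /= subr0; split => //; lra.
rewrite /abs_iter iterS -/(abs_iter n x) -real_normK ?num_real //.
have E3 : n.+3%:R = n%:R + 3 :> R by rewrite -addn3 natrD.
have E2 : n.+2%:R = n%:R + 2 :> R by rewrite -addn2 natrD.
move: p0 px pn x1 (ler0n R n) (normr_ge0 x); rewrite E3 E2.
move: (abs_iter n x) `|x| n%:R => p t k p0 px pn t1 k0 t0.
have q0 : 0 <= (t - p) * (t + p) by apply: mulr_ge0; lra.
have r0 : 0 <= (t - p) * (2 - (t + p)) by apply: mulr_ge0; lra.
split; [lra | lra |].
(* The goal amounts to [(t - p) * (2 - (t + p)) * (k + 3) <= 4], whose slack is exactly the product
   in [s0] plus twice that in [u0] plus the square in [v0]. *)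
have s0 : 0 <= (2 - (t - p) * (k + 2)) * (2 - (t - p)) by apply: mulr_ge0; lra.
have u0 : 0 <= (t - p) * p * (k + 3).
  by apply: mulr_ge0; [apply: mulr_ge0|]; lra.
have v0 : 0 <= (t - p) ^+ 2 by exact: sqr_ge0.
lra.
Qed.

Section UniformClosure.
Context {R : realType} {X : Type} (K : set X) (B : set (X -> R)).

Lemma subset_uniform_closure : B `<=` uniform_closure K B.
Proof. by move=> f Bf e e0; exists f => // x _; rewrite subrr normr0. Qed.

Lemma uniform_closure_uniform_closure f :
  uniform_closure K (uniform_closure K B) f -> uniform_closure K B f.
Proof.
move=> Bf e e0; have e20 : 0 < e / 2 by rewrite divr_gt0.
have [g Bg gf] := Bf _ e20; have [h Bh hg] := Bg _ e20.
exists h => // x Kx; rewrite (splitr e).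
rewrite (_ : h x - f x = (h x - g x) + (g x - f x)); last by rewrite subrKA.
by apply: le_lt_trans (ler_normD _ _) (ltrD (hg x Kx) (gf x Kx)).
Qed.

Hypothesis BD : forall f g, B f -> B g -> B (fun x => f x + g x).

Lemma uniform_closureD f g : uniform_closure K B f -> uniform_closure K B g ->
  uniform_closure K B (fun x => f x + g x).
Proof.
move=> Bf Bg e e0; have e20 : 0 < e / 2 by rewrite divr_gt0.
have [f' Bf' ff'] := Bf _ e20; have [g' Bg' gg'] := Bg _ e20.
exists (fun x => f' x + g' x); first exact: BD.
move=> x Kx; rewrite (splitr e) opprD addrACA.
exact: le_lt_trans (ler_normD _ _) (ltrD (ff' x Kx) (gg' x Kx)).
Qed.

Hypothesis BZ : forall c f, B f -> B (fun x => c * f x).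

Lemma uniform_closureZ c f : uniform_closure K B f ->
  uniform_closure K B (fun x => c * f x).
Proof.
move=> Bf e e0; have c0 : 0 < `|c| + 1 by rewrite ltr_wpDl.
have [g Bg fg] := Bf (e / (`|c| + 1)) (divr_gt0 e0 c0).
exists (fun x => c * g x); first exact: BZ.
move=> x Kx; rewrite -mulrBr normrM.
apply: le_lt_trans (_ : (`|c| + 1) * `|g x - f x| < _).
  by rewrite ler_wpM2r // lerDl.
by rewrite mulrC -ltr_pdivlMr // fg.
Qed.

End UniformClosure.

Section StoneWeierstrass.
Context {R : realType} {X : topologicalType} (K : set X) (B : set (X -> R)).
Hypotheses (cK : compact K) (cB : forall f, B f -> continuous f).
Hypotheses (Bcst : forall c, B (fun=> c))
  (BD : forall f g, B f -> B g -> B (fun x => f x + g x))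
  (BM : forall f g, B f -> B g -> B (fun x => f x * g x)).

(** If [g] in [B] is bounded by [M] on [K], then [M * abs_iter n (g / M)] is a polynomial in [g],
    hence in [B], and lies within [2 * M / (n + 2)] of [|g|] on [K]. *)
Lemma uniform_closure_norm f : uniform_closure K B f ->
  uniform_closure K B (fun x => `|f x|).
Proof.
move=> Bf; apply: uniform_closure_uniform_closure => d d0.
have [g Bg gf] := Bf _ d0; exists (fun x => `|g x|); last first.
  by move=> x Kx; apply: le_lt_trans (ler_dist_dist _ _) (gf x Kx).
move=> e e0.
have [M M0 gM] : exists2 M, 0 < M & forall x, K x -> `|g x| <= M.
  have [M [_ HM]] := compact_bounded (continuous_compact
    (continuous_subspaceT (cB _ Bg)) cK).
  exists (`|M| + 1); first by rewrite ltr_wpDl.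
  move=> x Kx; apply: HM; last by exists x.
  by rewrite (le_lt_trans (ler_norm M)) // ltrDl.
have [n ne] : exists n : nat, M * (2 / n.+2%:R) < e.
  exists (Num.truncn (2 * M / e)).
  rewrite mulrCA mulrA ltr_pdivrMr // -ltr_pdivrMl // [e^-1 * _]mulrC.
  by apply: lt_trans (truncnS_gt _) _; rewrite ltr_nat.
exists (fun x => M * abs_iter n (M^-1 * g x)).
  apply: BM => //; elim: n {ne} => [|n IH]; first exact: Bcst.
  have Bg' : B (fun x => M^-1 * g x) by exact: BM.
  have -> : (fun x => abs_iter n.+1 (M^-1 * g x)) =
      (fun x => abs_iter n (M^-1 * g x) + ((M^-1 * g x) * (M^-1 * g x)
         + (- 1) * (abs_iter n (M^-1 * g x) * abs_iter n (M^-1 * g x))) * 2^-1).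
    by apply/funext => x; rewrite /abs_iter iterS !expr2 mulN1r.
  by do !(apply: BD || apply: BM || apply: Bcst).
move=> x Kx.
have gx1 : `|M^-1 * g x| <= 1.
  by rewrite normrM normfV (gtr0_norm M0) mulrC ler_pdivrMr // mul1r gM.
have /andP[p0 pn] := abs_iter_bound R n _ gx1.
rewrite distrC.
have -> : `|g x| = M * `|M^-1 * g x|.
  by rewrite normrM normfV (gtr0_norm M0) mulrA divff ?gt_eqF // mul1r.
rewrite -mulrBr normrM (gtr0_norm M0) (ger0_norm p0).
by apply: le_lt_trans ne; rewrite ler_pM2l.
Qed.

Theorem Stone_Weierstrass f :
  (forall x y, K x -> K y -> x <> y -> exists2 g, B g & g x <> g y) ->
  continuous f -> uniform_closure K B f.
Proof.
move=> Bsep cf.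
have BZ c g : B g -> B (fun x => c * g x) by apply: BM; exact: Bcst.
(* Membership in the closure controls values on [K] only, so the continuity on [X] required by the
   lattice argument is carried along. *)
pose L := [set g : X -> R | continuous g /\ uniform_closure K B g].
have LB g : B g -> L g.
  by move=> Bg; split; [exact: cB|exact: subset_uniform_closure].
have LD g h : L g -> L h -> L (fun x => g x + h x).
  move=> [cg Bg] [ch Bh]; split; last exact: uniform_closureD.
  by move=> x; apply: cvgD; [exact: cg|exact: ch].
have LZ c g : L g -> L (fun x => c * g x).
  move=> [cg Bg]; split; last exact: uniform_closureZ.
  by move=> x; apply: cvgM; [exact: cvg_cst|exact: cg].
have Labs g : L g -> L (fun x => `|g x|).
  move=> [cg Bg]; split; last exact: uniform_closure_norm.
  by move=> x; apply: cvg_norm; exact: cg.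
apply: uniform_closure_uniform_closure => e e0.
have [g [_ Bg] gf] : exists2 g, L g & forall x, K x -> `|g x - f x| < e.
  apply: lattice_approx => //.
  - by move=> g [].
  - by exists (fun=> 0); apply/LB/Bcst.
  - move=> g h Lg Lh.
    have -> : (fun x => Num.max (g x) (h x)) =
        (fun x => 2^-1 * ((g x + h x) + `|g x + (-1) * h x|)).
      by apply/funext => x; rewrite maxr_absE mulrC mulN1r.
    by apply/LZ/LD; [exact: LD|apply/Labs/LD => //; exact: LZ].
  - move=> g h Lg Lh.
    have -> : (fun x => Num.min (g x) (h x)) =
        (fun x => 2^-1 * ((g x + h x) + (-1) * `|g x + (-1) * h x|)).
      by apply/funext => x; rewrite minr_absE mulrC !mulN1r.
    by apply/LZ/LD; [exact: LD|apply/LZ/Labs/LD => //; exact: LZ].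
  move=> x y d Kx Ky d0.
  have [->|/eqP xy] := eqVneq x y.
    by exists (fun=> f y); [apply/LB/Bcst|rewrite subrr normr0].
  have [g Bg gxy] := Bsep x y Kx Ky xy.
  (* The affine function of the separating [g] that equals [f x] at [x] and [f y] at [y]. *)
  exists (fun z => f x + (f y - f x) / (g y - g x) * (g z + - g x)).
    by apply/LB; do !(apply: BD || apply: BZ || apply: Bcst || exact: Bg).
  have gyx : g y - g x != 0 by rewrite subr_eq0; apply/eqP/nesym.
  rewrite subrr mulr0 addr0 subrr normr0 mulfVK // addrCA subrr addr0.
  by rewrite subrr normr0.
by exists g.
Qed.

End StoneWeierstrass.

(** * One-variable approximation by a sigmoidal function *)

(** The scale [w] exceeds both thresholds beyond which [sigma] is within [e] of its limits, so the
    transition of the rescaled function is squeezed into [[-1, 1]]. *)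
Lemma sigmoidal_steep {R : realType} (sigma : R -> R) : sigmoidal sigma ->
  forall e, 0 < e -> exists2 w : R, 0 < w & forall u : R,
    (1 <= u -> `|sigma (w * u) - 1| < e) /\ (u <= -1 -> `|sigma (w * u)| < e).
Proof.
move=> [s1 s0] e e0.
have /cvgrPdist_lt /(_ e e0) [M1 [_ M1s]] := s1.
have /cvgrPdist_lt /(_ e e0) [M0 [_ M0s]] := s0.
have w0 : 0 < `|M1| + `|M0| + 1 by rewrite ltr_wpDl // addr_ge0.
have M1w : M1 < `|M1| + `|M0| + 1.
  by rewrite (le_lt_trans (ler_norm _)) // -addrA ltrDl ltr_wpDl.
have M0w : - M0 < `|M1| + `|M0| + 1.
  by rewrite (le_lt_trans (ler_norm _)) // normrN addrAC ltrDr ltr_wpDl.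
exists (`|M1| + `|M0| + 1) => // u; split => u1.
- rewrite distrC; apply: M1s; apply: lt_le_trans M1w _.
  by rewrite ler_peMr // ltW.
- rewrite -normrN -sub0r; apply: M0s; rewrite -ltrN2 -mulrN.
  by apply: lt_le_trans M0w _; rewrite ler_peMr ?(ltW w0) // lerNr.
Qed.

(** On a segment continuity gives a bound; outside it the values are within [1] of a limit [0] or
    [1], hence below [2] in absolute value. *)
Lemma sigmoidal_bounded {R : realType} (sigma : R -> R) :
  continuous sigma -> sigmoidal sigma ->
  exists2 C : R, 0 <= C & forall z, `|sigma z| <= C.
Proof.
move=> cs ss; have [w w0 ws] := sigmoidal_steep sigma ss 1 ltr01.
have [M [_ HM]] := compact_bounded (continuous_compact
  (continuous_subspaceT cs) (@segment_compact R (- w) w)).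
exists (`|M| + 2) => [|z]; first by rewrite addr_ge0.
have [zw|zw] := leP `|z| w.
  apply: HM; last by exists z => //=; rewrite in_itv /= -ler_norml.
  by rewrite (le_lt_trans (ler_norm M)) // ltrDl.
have [] := ws (w^-1 * z); rewrite mulVKf ?gt_eqF // => w1 w2.
have M0 := normr_ge0 M.
move: zw; rewrite ltNge ler_norml negb_and -!ltNge => /orP[zw|zw].
  have /w2 : w^-1 * z <= -1 by rewrite mulrC ler_pdivrMr // mulN1r ltW.
  lra.
have /w1 : 1 <= w^-1 * z by rewrite mulrC ler_pdivlMr // mul1r ltW.
have := ler_normD (sigma z - 1) 1; rewrite subrK normr1; lra.
Qed.

(* Away from the two nodes nearest to [s], each smoothed step is within [de] of
   the Heaviside step; the two others err by at most [C + 1]. Every step is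
   weighted by an increment of [g], at most [L / n]. *)
Lemma sigmoidal_sum_lipschitz {R : realType} (sigma g : R -> R) (L e : R) :
  continuous sigma -> sigmoidal sigma -> 0 <= L ->
  (forall s t : R, 0 <= s <= 1 -> 0 <= t <= 1 -> `|g s - g t| <= L * `|s - t|) ->
  0 < e -> exists (n : nat) (w : R), forall s : R, 0 <= s <= 1 ->
  `|g 0 + \sum_(i < n) (g (i.+1%:R / n%:R) - g (i%:R / n%:R)) *
      sigma (w * (n%:R * s - i.+1%:R)) - g s| < e.
Proof.
move=> cs ss L0 gL e0.
have [C C0 sC] := sigmoidal_bounded sigma cs ss.
have L10 : 0 < L + 1 by rewrite ltr_wpDl.
(* Dividing by [L + 1] rather than [L] allows [L = 0] and leaves [L * de] below [e / 2] by exactly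
   [de], which makes the final inequality strict. *)
have de0 : 0 < e / (2 * (L + 1)) by rewrite divr_gt0 // mulr_gt0.
have [w w0 ws] := sigmoidal_steep sigma ss _ de0.
set de := e / _ in de0 ws.
(* In [2 * C + 3], the part [2 * (C + 1)] pays for the two exceptional steps and the remaining [1]
   for moving from the node [k / n] to [s]; each is weighted by [L / n]. *)
pose n := (Num.truncn (2 * (2 * C + 3) * (L + 1) / e)).+1.
have n0 : 0 < n%:R :> R by [].
exists n, w => s /andP[s0 s1].
(* The last node not beyond [s] is [k / n]; the value [k = n] occurs at [s = 1]. *)
pose k := Num.truncn (n%:R * s).
have ns0 : 0 <= n%:R * s by rewrite mulr_ge0.
have /andP[kns nsk] := truncn_itv ns0; rewrite -/k in kns nsk.
have kn : (k <= n)%N.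
  by rewrite -(ler_nat R) (le_trans kns) // ler_piMr.
have node i : (i <= n)%N -> 0 <= (i%:R / n%:R : R) <= 1.
  by move=> ni; rewrite divr_ge0 //= ler_pdivrMr // mul1r ler_nat.
pose D (i : nat) := g (i.+1%:R / n%:R) - g (i%:R / n%:R).
have DL (i : 'I_n) : `|D i| <= L / n%:R.
  apply: le_trans (gL _ _ (node _ (ltn_ord i)) (node _ (ltnW (ltn_ord i)))) _.
  by rewrite -mulrBl -natrB // subSnn mul1r gtr0_norm ?invr_gt0.
(* With exact Heaviside steps the sum telescopes to the value of [g] at the node [k / n]. *)
have gk : g (k%:R / n%:R) = g 0 + \sum_(i < n) D i * (i < k)%:R.
  have -> : \sum_(i < n) D i * (i < k)%:R = \sum_(i < k) D i.
    rewrite (big_ord_widen n D kn) [RHS]big_mkcond.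
    by apply: eq_bigr => i _; case: ifP; rewrite ?mulr1 ?mulr0.
  rewrite -(big_mkord xpredT D) telescope_sumr // mul0r; ring.
have gks : `|g (k%:R / n%:R) - g s| <= L / n%:R.
  apply: le_trans (gL _ _ (node _ kn) _) _; first by rewrite s0.
  rewrite ler_wpM2l // distrC ger0_norm; last first.
    by rewrite subr_ge0 ler_pdivrMr // mulrC.
  rewrite -(ler_pM2l n0) divff ?gt_eqF // mulrBr mulrCA divff ?gt_eqF // mulr1.
  by rewrite lerBlDl natr1 ltW.
(* Step [i] is centred at node [i + 1]: the argument [n * s - (i + 1)] is at least [1] if
   [i + 1 < k] and at most [-1] if [i > k]. The exceptions are [i + 1 = k] and [i = k]. *)
have term (i : 'I_n) : `|D i * sigma (w * (n%:R * s - i.+1%:R)) - D i * (i < k)%:R|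
    <= L / n%:R * (de + (C + 1) * ((i.+1 == k)%:R + (nat_of_ord i == k)%:R)).
  rewrite -mulrBr normrM; apply: ler_pM => //.
  have [w1 w2] := ws (n%:R * s - i.+1%:R).
  have rough (b : bool) : `|sigma (w * (n%:R * s - i.+1%:R)) - b%:R| <= C + 1 :> R.
    apply: le_trans (ler_normB _ _) (lerD (sC _) _).
    by case: b; rewrite ?normr1 ?normr0 ?ler01.
  have [ik|ik|ik] := ltngtP i.+1 k.
  - rewrite (ltn_eqF (ltnW ik)) addr0 mulr0 addr0.
    by apply/ltW/w1; rewrite lerBrDr addrC natr1 (le_trans _ kns) // ler_nat.
  - have ki : (k <= i)%N by [].
    rewrite add0r; move: ki; rewrite leq_eqVlt => /orP[/eqP ->|ki].
      have := rough false; rewrite eqxx /=; lra.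
    rewrite subr0 (gtn_eqF ki) mulr0 addr0; apply/ltW/w2.
    rewrite lerBlDr addrC -natr1 addrK (le_trans (ltW nsk)) //.
    by rewrite ler_nat.
  - have := rough true; rewrite -ik ltn_eqF //=; lra.
have -> : g 0 + \sum_(i < n) D i * sigma (w * (n%:R * s - i.+1%:R)) - g s =
   (\sum_(i < n) (D i * sigma (w * (n%:R * s - i.+1%:R)) - D i * (i < k)%:R)) +
   (g (k%:R / n%:R) - g s).
  by rewrite gk sumrB; ring.
apply: le_lt_trans (ler_normD _ _) _.
(* Each kind of exception occurs for at most one index. *)
have sum1 (f : 'I_n -> nat) : injective f -> \sum_(i < n) (f i == k)%:R <= 1 :> R.
  move=> finj; have [j /eqP fj|nf] := pickP (fun i => f i == k).
    rewrite (bigD1 j) //= fj eqxx big1 ?addr0 // => i ij.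
    by rewrite -fj (inj_eq finj) (negbTE ij).
  by rewrite big1 // => i _; rewrite nf.
have sumle : `|\sum_(i < n)
      (D i * sigma (w * (n%:R * s - i.+1%:R)) - D i * (i < k)%:R)| <=
    L * de + L / n%:R * ((C + 1) * 2).
  apply: le_trans (ler_norm_sum _ _ _) _.
  apply: le_trans (ler_sum _ (fun i _ => term i)) _.
  rewrite -mulr_sumr big_split /= sumr_const card_ord -[de *+ n]mulr_natr.
  rewrite (_ : L * de = L / n%:R * (de * n%:R)); last first.
    by field; rewrite gt_eqF.
  rewrite -mulrDr ler_wpM2l ?divr_ge0 // lerD2l.
  rewrite -mulr_sumr ler_wpM2l ?addr_ge0 //.
  rewrite big_split /= lerD // sum1 //; first by move=> i j [] /val_inj.
  exact: val_inj.
apply: le_lt_trans (lerD sumle gks) _.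
have Lde : L * de + de = e / 2 by rewrite /de; field; rewrite gt_eqF.
have nL : L / n%:R * (2 * C + 3) <= e / 2.
  have := truncnS_gt (2 * (2 * C + 3) * (L + 1) / e); rewrite -/n.
  rewrite ltr_pdivrMr // => nL.
  by rewrite mulrAC ler_pdivrMr //; lra.
lra.
Qed.

(** * Sums of exponentials *)

(** For [x <= y], the tangent inequality [1 + (x - y) <= expR (x - y)] multiplied by [expR y] bounds
    [expR y - expR x] by [expR y * (y - x)]. *)
Lemma expR_lipschitz {R : realType} (M x y : R) : x <= M -> y <= M ->
  `|expR x - expR y| <= expR M * `|x - y|.
Proof.
wlog xy : x y / x <= y => [hw xM yM|xM yM].
  have [xy|/ltW yx] := leP x y; first exact: hw.
  by rewrite distrC [`|x - y|]distrC hw.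
rewrite distrC [`|x - y|]distrC !ger0_norm ?subr_ge0 ?ler_expR //.
have := expR_ge1Dx (x - y); rewrite expRD expRN => h.
have eyM : expR y <= expR M by rewrite ler_expR.
have ey := expR_gt0 y.
apply: le_trans (_ : expR y * (y - x) <= _); last by rewrite ler_wpM2r // subr_ge0.
move: h; rewrite -(ler_pM2l ey) mulrCA divff ?gt_eqF // mulr1; lra.
Qed.

Section ExponentialSums.
Context {R : realType} {X : Type} (Lam : set (X -> R)).

(** Nonempty finite sums, given inductively so that products and approximations are treated term by
    term. *)
Inductive exp_sum : (X -> R) -> Prop :=
| exp_sum1 c l : Lam l -> exp_sum (fun x => c * expR (l x))
| exp_sumD f g : exp_sum f -> exp_sum g -> exp_sum (fun x => f x + g x).

Lemma exp_sumM :
  (forall l m, Lam l -> Lam m -> Lam (fun x => l x + m x)) ->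
  forall f g, exp_sum f -> exp_sum g -> exp_sum (fun x => f x * g x).
Proof.
move=> LamD f g; elim=> [c l Ll|f1 f2 _ IH1 _ IH2] Eg; last first.
  rewrite (_ : (fun _ => _) = (fun x => f1 x * g x + f2 x * g x)).
    by apply: exp_sumD; [exact: IH1|exact: IH2].
  by apply/funext => x; rewrite mulrDl.
elim: Eg => [c' l' Ll'|g1 g2 _ IH1 _ IH2].
  rewrite (_ : (fun _ => _) = (fun x => (c * c') * expR (l x + l' x))).
    by apply: exp_sum1; exact: LamD.
  by apply/funext => x; rewrite expRD mulrACA.
rewrite (_ : (fun _ => _) =
    (fun x => c * expR (l x) * g1 x + c * expR (l x) * g2 x)).
  exact: exp_sumD.
by apply/funext => x; rewrite mulrDr.
Qed.

End ExponentialSums.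

Section ExponentialDensity.
Context {R : realType} {X : topologicalType} (K : set X) (Lam : set (X -> R)).
Hypotheses (cK : compact K) (cLam : forall l, Lam l -> continuous l).

(** Stone-Weierstrass applies: the zero form yields the constants, additivity of [Lam] yields
    products, and injectivity of [expR] transfers separation of points from [Lam]. *)
Lemma exp_sum_dense :
  Lam (fun=> 0) -> (forall l m, Lam l -> Lam m -> Lam (fun x => l x + m x)) ->
  (forall x y, K x -> K y -> x <> y -> exists2 l, Lam l & l x <> l y) ->
  forall f, continuous f -> uniform_closure K (exp_sum Lam) f.
Proof.
move=> Lam0 LamD Lsep f cf; apply: Stone_Weierstrass => //.
- move=> g; elim=> [c l Ll|g1 g2 _ c1 _ c2] x.
    apply: cvgM; first exact: cvg_cst.
    by apply: continuous_comp; [exact: cLam|exact: continuous_expR].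
  by apply: cvgD; [exact: c1|exact: c2].
- move=> c; rewrite (_ : (fun _ => _) = (fun x : X => c * expR 0)).
    exact: (@exp_sum1 _ _ Lam c (fun=> 0)).
  by apply/funext => x; rewrite expR0 mulr1.
- exact: exp_sumD.
- exact: exp_sumM.
- move=> x y Kx Ky /(Lsep _ _ Kx Ky)[l Ll lxy].
  exists (fun z => 1 * expR (l z)); first exact: exp_sum1.
  by rewrite !mul1r => /expR_inj.
Qed.

Variables (sigma : R -> R) (A : set (X -> R)).
Hypotheses (csigma : continuous sigma) (ssigma : sigmoidal sigma).
Hypotheses (A0 : A (fun=> 0))
  (AD : forall f g, A f -> A g -> A (fun x => f x + g x))
  (AZ : forall c f, A f -> A (fun x => c * f x))
  (Asigma : forall l a b, Lam l -> A (fun x => sigma (a * l x + b))).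

(** By linearity a single [expR (l x)] suffices. Since [|l| <= M] on [K], the substitution
    [s = (l x + M) / (2 * M)] maps into [[0, 1]], where the one-variable result applies to [g]. *)
Lemma exp_sum_sigmoidal f : exp_sum Lam f -> uniform_closure K A f.
Proof.
elim=> {f} [c l Ll|f g _ IHf _ IHg]; last exact: uniform_closureD.
apply: uniform_closureZ => // e e0.
have [M M0 lM] : exists2 M, 0 < M & forall x, K x -> `|l x| <= M.
  have [M [_ HM]] := compact_bounded (continuous_compact
    (continuous_subspaceT (cLam _ Ll)) cK).
  exists (`|M| + 1); first by rewrite ltr_wpDl.
  move=> x Kx; apply: HM; last by exists x.
  by rewrite (le_lt_trans (ler_norm M)) // ltrDl.
pose g s := expR (2 * M * s - M).
have gL s t : 0 <= s <= 1 -> 0 <= t <= 1 ->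
    `|g s - g t| <= expR M * (2 * M) * `|s - t|.
  move=> /andP[s0 s1] /andP[t0 t1].
  apply: le_trans (expR_lipschitz M _ _ _ _) _; [nra|nra|].
  rewrite -[leRHS]mulrA ler_wpM2l ?expR_ge0 //.
  rewrite (_ : _ - _ = 2 * M * (s - t)); last by ring.
  by rewrite normrM gtr0_norm // mulr_gt0.
have L0 : 0 <= expR M * (2 * M) by rewrite !mulr_ge0 ?expR_ge0 // ltW.
have [n [w Hn]] := sigmoidal_sum_lipschitz sigma g _ e csigma ssigma L0 gL e0.
(* A point where [sigma] does not vanish, found near the limit [1], realizes constants as multiples
   of [sigma (0 * l x + b)]. *)
have [b b0] : exists b, sigma b != 0.
  have [v _ /(_ 1) [/(_ (lexx _))]] := sigmoidal_steep sigma ssigma 1 ltr01.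
  have [->|? _ _] := eqVneq (sigma (v * 1)) 0; last by exists (v * 1).
  by rewrite sub0r normrN normr1 ltxx.
have Acst c' : A (fun=> c').
  rewrite (_ : (fun _ => _) = (fun x => c' / sigma b * sigma (0 * l x + b))).
    by apply: AZ; exact: Asigma.
  by apply/funext => x; rewrite mul0r add0r divfK.
have Asum m (h : 'I_m -> X -> R) : (forall i, A (h i)) ->
    A (fun x => \sum_(i < m) h i x).
  elim: m h => [|m IH] h Ah.
    by rewrite (_ : (fun _ => _) = fun=> 0) //; apply/funext => x; rewrite big_ord0.
  rewrite (_ : (fun _ => _) = fun x => h ord0 x + \sum_(i < m) h (lift ord0 i) x).
    by apply: AD => //; exact: IH.
  by apply/funext => x; rewrite big_ord_recl.
(* The weight and the bias come from expanding [w * (n * s - (i + 1))] at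
   [s = (l x + M) / (2 * M)]. *)
exists (fun x => g 0 + \sum_(i < n) (g (i.+1%:R / n%:R) - g (i%:R / n%:R)) *
    sigma ((w * n%:R / (2 * M)) * l x + (w * n%:R / 2 - w * i.+1%:R))).
  apply: AD => //; apply: Asum => i; apply: AZ; exact: Asigma.
move=> x Kx; have := lM x Kx; rewrite ler_norml => /andP[lM1 lM2].
have := Hn ((l x + M) / (2 * M)).
have -> : g ((l x + M) / (2 * M)) = expR (l x).
  by congr expR; field; rewrite gt_eqF.
have lin (i : 'I_n) : w * (n%:R * ((l x + M) / (2 * M)) - i.+1%:R) =
    w * n%:R / (2 * M) * l x + (w * n%:R / 2 - w * i.+1%:R).
  by field; rewrite gt_eqF.
under eq_bigr => i _ do rewrite lin.
by apply; rewrite divr_ge0 ?ler_pdivrMr ?mulr_gt0 ?mulr_ge0 //; lra.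
Qed.

End ExponentialDensity.

(** * Ridge functions of space and time *)

Section RidgeSums.
Context {R : realType} {d : nat}.

Lemma ridge_form_continuous (k : 'cV[R]_d) (r : R) :
  continuous (fun z : 'cV[R]_d * R => (k^T *m z.1) 0 0 + r * z.2).
Proof.
move=> z; apply: cvgD; last first.
  by apply: cvgM; [exact: cvg_cst|exact: cvg_snd].
have -> : (fun z : 'cV[R]_d * R => (k^T *m z.1) 0 0) =
    (fun z => \sum_(i < d) k^T 0 i * z.1 i 0).
  by apply/funext => y; rewrite mxE.
rewrite mxE; apply: (cvg_big add_continuous) => i _; apply: cvgM.
  exact: cvg_cst.
apply: (@continuous_comp _ _ _ fst (fun M : 'cV[R]_d => M i 0)).
  exact: cvg_fst.
exact: coord_continuous.
Qed.

Lemma ridge_sum_continuous (sigma : R -> R) N (u : 'I_N -> R)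
    (kx : 'I_N -> 'cV[R]_d) (kt b : 'I_N -> R) : continuous sigma ->
  continuous (fun z : 'cV[R]_d * R => ridge_sum sigma u kx kt b z.1 z.2).
Proof.
move=> cs z; apply: (cvg_big add_continuous) => j _; apply: cvgM.
  exact: cvg_cst.
apply: (@continuous_comp _ _ _
  (fun z : 'cV[R]_d * R => ((kx j)^T *m z.1) 0 0 + kt j * z.2 + b j)).
  by apply: cvgD; [exact: ridge_form_continuous|exact: cvg_cst].
exact: cs.
Qed.

Lemma ridge_sum_dense (K : set ('cV[R]_d * R)) (sigma : R -> R)
    (f : set_type K -> R) (e : R) :
  compact K -> continuous sigma -> sigmoidal sigma -> continuous f -> 0 < e ->
  exists (N : nat) (u : 'I_N -> R) (kx : 'I_N -> 'cV[R]_d)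
      (kt b : 'I_N -> R), (0 < N)%N /\ forall z : set_type K,
    `|ridge_sum sigma u kx kt b (set_val z).1 (set_val z).2 - f z| < e.
Proof.
move=> cK cs ss cf.
pose X := subspace K.
pose form (k : 'cV[R]_d) (r : R) : X -> R :=
  fun z : 'cV[R]_d * R => (k^T *m z.1) 0 0 + r * z.2.
pose Lam : set (X -> R) := [set l | exists k r, l = form k r].
pose A : set (X -> R) := [set g | exists (N : nat) (u : 'I_N -> R)
  (kx : 'I_N -> 'cV[R]_d) (kt b : 'I_N -> R), (0 < N)%N /\
  g = fun z : 'cV[R]_d * R => ridge_sum sigma u kx kt b z.1 z.2].
have cKX : compact (K : set X).
  by move: cK; rewrite -{1}[K]setIid => /compact_subspaceIP; rewrite setIid.
have cLam l : Lam l -> continuous l.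
  move=> [k [r ->]]; apply: continuous_subspaceT.
  exact: ridge_form_continuous.
(* The extension by the default value [0] is continuous because points outside [K] are isolated in
   [subspace K]. *)
pose F : X -> R := 'valL_(0 : R) f.
have cF : continuous F by exact/subspace_valL_continuousP'.
have FA : uniform_closure (K : set X) A F.
  (* Two approximations are chained: [F] by exponential sums, then each exponential sum by ridge
     sums. *)
  apply: uniform_closure_uniform_closure => c c0.
  have EF : uniform_closure (K : set X) (exp_sum Lam) F.
    apply: exp_sum_dense => //.
    - by exists 0, 0; apply/funext => z; rewrite /form trmx0 mul0mx mxE mul0r addr0.
    - move=> _ _ [k [r ->]] [k' [r' ->]]; exists (k + k'), (r + r').
      apply/funext => z; by rewrite /form linearD mulmxDl [in RHS]mxE mulrDl addrACA.
    (* Equal space components are separated by time, distinct ones by a coordinate in which they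
       differ. *)
    - move=> [x s] [y t] _ _ xyst; have [xy|/eqP xy] := eqVneq x y.
        exists (form 0 1); first by exists 0, 1.
        rewrite /form /= trmx0 !mul0mx mxE !mul1r !add0r => st.
        by apply: xyst; rewrite xy st.
      have [i xyi] : exists i, x i 0 <> y i 0.
        apply/not_existsP => xyi; apply/xy/matrixP => i j; rewrite ord1.
        by apply: contrapT; exact: xyi.
      exists (form (delta_mx i 0) 0); first by exists (delta_mx i 0), 0.
      by rewrite /form /= trmx_delta -!rowE !mxE !mul0r !addr0.
  have [g Eg gF] := EF c c0; exists g => //.
  apply: (exp_sum_sigmoidal _ _ _ _ sigma) Eg => //.
  (* One term of weight [0], as the sum must have at least one term. *)
  - exists 1%N, (fun=> 0), (fun=> 0), (fun=> 0), (fun=> 0); split=> //.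
    by apply/funext => z; rewrite /ridge_sum big_ord1 mul0r.
  - move=> _ _ [N [u [kx [kt [b [N0 ->]]]]]] [N' [u' [kx' [kt' [b' [N0' ->]]]]]].
    (* Adding two ridge sums concatenates their parameter families. *)
    pose glue (T : Type) (h : 'I_N -> T) (h' : 'I_N' -> T) i :=
      match fintype.split i with inl j => h j | inr j => h' j end.
    exists (N + N')%N, (glue _ u u'), (glue _ kx kx'), (glue _ kt kt'),
      (glue _ b b').
    split; first by rewrite addn_gt0 N0.
    apply/funext => z; rewrite /ridge_sum big_split_ord /=.
    have glueL T (h : 'I_N -> T) h' j : glue T h h' (lshift N' j) = h j.
      by rewrite /glue (unsplitK (inl j)).
    have glueR T (h : 'I_N -> T) h' j : glue T h h' (rshift N j) = h' j.
      by rewrite /glue (unsplitK (inr j)).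
    by congr (_ + _); apply: eq_bigr => j _; rewrite !(glueL, glueR).
  - move=> c' _ [N [u [kx [kt [b [N0 ->]]]]]].
    exists N, (fun j => c' * u j), kx, kt, b; split=> //.
    apply/funext => z; rewrite /ridge_sum mulr_sumr.
    by apply: eq_bigr => j _; rewrite mulrA.
  - move=> _ a c' [k [r ->]].
    exists 1%N, (fun=> 1), (fun=> a *: k), (fun=> a * r), (fun=> c'); split=> //.
    apply/funext => z; rewrite /ridge_sum big_ord1 mul1r /form.
    by rewrite linearZ -scalemxAl [in RHS]mxE mulrDr mulrA.
move=> e0; have [_ [N [u [kx [kt [b [N0 ->]]]]]] FN] := FA e e0.
exists N, u, kx, kt, b; split=> // z.
by have := FN (set_val z) (set_valP z); rewrite /F -[in f z](valLK (0 : R) f).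
Qed.

End RidgeSums.

Theorem theorem2p1 (R : realType) (d : nat) (hd : (1 <= d)%N)
    (Omega : set 'cV[R]_d) (hOmega : compact Omega)
    (T : R) (hT : 0 < T)
    (sigma : R -> R) (hsigma : continuous sigma)
    (hsigmoidal : sigmoidal sigma) :
  dense (ridge_sums sigma (spacetime Omega T)) /\
  forall (f : Cspace R (spacetime Omega T)) (e : R), 0 < e ->
    exists (N : nat) (u : 'I_N -> R) (kx : 'I_N -> 'cV[R]_d)
      (kt b : 'I_N -> R), (0 < N)%N /\
      forall z : set_type (spacetime Omega T),
        `|ridge_sum sigma u kx kt b (set_val z).1 (set_val z).2 - f z| < e.
Proof.
have cK : compact (spacetime Omega T).
  by apply: compact_setX => //; exact: segment_compact.
have approx (f : Cspace R (spacetime Omega T)) (e : R) : 0 < e ->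
    exists (N : nat) (u : 'I_N -> R) (kx : 'I_N -> 'cV[R]_d)
      (kt b : 'I_N -> R), (0 < N)%N /\
      forall z : set_type (spacetime Omega T),
        `|ridge_sum sigma u kx kt b (set_val z).1 (set_val z).2 - f z| < e.
  by apply: ridge_sum_dense => //; exact: cts_fun.
split=> // O [f Of] oO.
have /(nbhs_CspaceP _ _ cK) [e e0 eO] : nbhs f O by exact: open_nbhs_nbhs.
(* Halving leaves room: strict pointwise bounds by [e / 2] only give a supremum at most [e / 2]. *)
have e20 : 0 < e / 2 by rewrite divr_gt0.
have [N [u [kx [kt [b [N0 uf]]]]]] := approx f _ e20.
pose h (z : set_type (spacetime Omega T)) : R :=
  ridge_sum sigma u kx kt b (set_val z).1 (set_val z).2.
have ch : continuous h.
  move=> z; apply: (@continuous_comp _ _ _ set_val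
    (fun z => ridge_sum sigma u kx kt b z.1 z.2)).
    exact: initial_continuous.
  exact: ridge_sum_continuous.
pose g : continuousType (set_type (spacetime Omega T)) R :=
  mkcts ch.
exists (g : Cspace R (spacetime Omega T)); split.
  apply: eO; apply: (@le_lt_trans _ _ (e / 2)); last by lra.
  rewrite /supnorm; set S := (X in sup X).
  (* If the domain is empty, [supnorm] is the supremum of the empty set, which is [0]. *)
  have [->|/set0P S0] := eqVneq S set0; first by rewrite sup0 ltW.
  by apply: ge_sup => // _ [z _ <-]; exact/ltW/uf.
by exists N, u, kx, kt, b.
Qed.
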